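(* Let $p$ be an odd prime, $q\in\mathbb{C}_p$ with $q\neq 1$ and $|q-1|_p<p^{-1/(p-1)}$, $\lambda\in\mathbb{C}_p$ with $\lambda\ne 0$, and $x\in\mathbb{C}_p$ with $|x|_p\le 1$. For every integer $n\ge 0$, $$E_{n,q}(x)=\sum_{m=0}^n E_{m,q}(x|\lambda)\,\lambda^{n-m}S_2(n,m),$$ where $S_2(n,m)$ is the Stirling number of the second kind.
   Context: $\mathbb{Z}_p$ is the ring of $p$-adic integers and $\mathbb{C}_p$ the completion of the algebraic closure of $\mathbb{Q}_p$, with $|p|_p=1/p$. For $|z|_p\le 1$, $q^z=\exp(z\log q)$ and $[z]_q=\frac{1-q^z}{1-q}$; also $[N]_{-q}=\frac{1-(-q)^N}{1+q}$ for integers $N\ge 0$. The fermionic $p$-adic $q$-integral of a continuous function $f:\mathbb{Z}_p\to\mathbb{C}_p$ is $$\int_{\mathbb{Z}_p}f(y)\,d\mu_{-q}(y)=\lim_{N\to\infty}\frac{1}{[p^N]_{-q}}\sum_{y=0}^{p^N-1}f(y)(-q)^y .$$ Carlitz's type $q$-Euler numbers $E_{n,q}$ are defined by $E_{0,q}=1$ and $q(qE_q+1)^n+E_{n,q}=0$ for $n\ge1$, where after binomial expansion $E_q^k$ is replaced by $E_{k,q}$. The $q$-Euler polynomials are $E_{n,q}(x)=\sum_{l=0}^n\binom{n}{l}q^{lx}E_{l,q}[x]_q^{n-l}$ for $n\ge0$; equivalently $E_{n,q}(x)=\int_{\mathbb{Z}_p}[x+y]_q^n\,d\mu_{-q}(y)$.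 The degenerate $q$-Euler polynomials $E_{n,q}(x|\lambda)$ are defined by the generating function $$\int_{\mathbb{Z}_p}(1+\lambda t)^{\frac{1}{\lambda}[x+y]_q}\,d\mu_{-q}(y)=\sum_{n=0}^\infty E_{n,q}(x|\lambda)\frac{t^n}{n!},$$ where $(1+\lambda t)^{z/\lambda}=\exp\left(\frac{z}{\lambda}\log(1+\lambda t)\right)$ is expanded as a power series in $t$ and the integral is taken coefficientwise. Stirling numbers of the second kind: $X^n=\sum_{m=0}^n S_2(n,m)X(X-1)\cdots(X-m+1)$. *)

(* Defs.v *)
From HB Require Import structures.
From mathcomp Require Import all_boot all_order all_algebra.
From mathcomp Require Import all_classical all_reals all_analysis.
From mathcomp Require Import ring.

Set Implicit Arguments.
Unset Strict Implicit.
Unset Printing Implicit Defensive.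

Import Order.TTheory GRing.Theory Num.Theory.

Local Open Scope classical_set_scope.
Local Open Scope ring_scope.

(* Fields with an ultrametric absolute value normalized by |p| = 1/p.
   [Num.NormedZmodule] cannot be used here: its axiom
   `|x *+ n| = `|x| *+ n excludes every ultrametric norm. *)
HB.mixin Record isPadicValued (p : nat) (R : realType) K of GRing.Field K := {
  pabs : K -> R;
  pabs_ge0 : forall x, 0 <= pabs x;
  pabs_eq0 : forall x, (pabs x == 0) = (x == 0);
  pabsM : forall x y, pabs (x * y) = pabs x * pabs y;
  pabs_ultra : forall x y, pabs (x + y) <= Num.max (pabs x) (pabs y);
  pabs_p : pabs p%:R = p%:R^-1
}.

#[short(type="padicFieldType")]
HB.structure Definition PadicField (p : nat) (R : realType) :=
  {K of GRing.Field K & isPadicValued p R K}.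

Section Metric.
Variables (p : nat) (R : realType) (K : padicFieldType p R).
Implicit Types x y z : K.

Lemma pabs0 : pabs (0 : K) = 0.
Proof. by apply/eqP; rewrite pabs_eq0. Qed.

Lemma pabs1 : pabs (1 : K) = 1.
Proof.
have n0 : pabs (1 : K) != 0 by rewrite pabs_eq0 oner_eq0.
by apply: (mulfI n0); rewrite -pabsM !mulr1.
Qed.

Lemma pabsN x : pabs (- x) = pabs x.
Proof.
suff N1 : pabs (- 1 : K) = 1 by rewrite -mulN1r pabsM N1 mul1r.
apply/eqP; rewrite -(@eqrXn2 _ 2) ?pabs_ge0 ?ler01 //.
by rewrite expr1n expr2 -pabsM mulrNN mulr1 pabs1.
Qed.

Definition pdist x y : R := pabs (x - y).

Lemma pdistxx x : pdist x x = 0.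
Proof. by rewrite /pdist subrr pabs0. Qed.

Lemma pdist_positivity x y : pdist x y = 0 -> x = y.
Proof. by move/eqP; rewrite pabs_eq0 subr_eq0 => /eqP. Qed.

Lemma pdist_sym x y : pdist x y = pdist y x.
Proof. by rewrite /pdist -pabsN opprB. Qed.

Lemma pdist_triangle y x z : pdist x z <= pdist x y + pdist y z.
Proof.
rewrite /pdist -[x - z](subrKA y); apply: le_trans (pabs_ultra _ _) _.
by rewrite ge_max lerDl lerDr !pabs_ge0.
Qed.

HB.instance Definition _ := isMetric.Build R K
  pdistxx pdist_positivity pdist_sym pdist_triangle.
HB.instance Definition _ := isPointed.Build K 0.

End Metric.

Section PadicComplex.
Variables (p : nat) (R : realType) (K : padicFieldType p R).

(* When K is complete, the closures of Q and of the naturals in K are copies of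
   the p-adic numbers and of the p-adic integers. *)
Definition padicQ : set K := closure (range (ratr : rat -> K)).

Definition padicZ : set K := closure (range (fun n : nat => n%:R : K)).

Lemma padicZ_subproof (n : nat) : (n%:R : K) \in padicZ.
Proof. by apply/mem_set/subset_closure; exists n. Qed.

Definition padicZ_nat (n : nat) : padicZ := SigSub (padicZ_subproof n).

Definition padicQbar : set K :=
  [set x | exists P : {poly K}, [/\ P != 0, forall i, padicQ P`_i & root P x]].

(* K is C_p: it is complete, and its elements algebraic over Q_p form a dense
   algebraically closed subfield, so that K is a completion of an algebraic
   closure of Q_p.  This determines K up to isometric isomorphism. *)
Record is_padic_complex : Prop := IsPadicComplex {
  padic_complete : forall F : set_system K, ProperFilter F -> cauchy F -> cvg F;
  padicQbar_closed : forall P : {poly K}, (1 < size P)%N ->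
    (forall i, padicQbar P`_i) -> exists2 x, padicQbar x & root P x;
  padicQbar_dense : dense padicQbar
}.

End PadicComplex.

Arguments padicZ {p R} K.
Arguments padicZ_nat {p R} K n.
Arguments padicQ {p R} K.
Arguments padicQbar {p R} K.

Section PadicAnalysis.
Variables (p : nat) (R : realType) (K : padicFieldType p R).
Implicit Types (q z x lambda : K).

Definition plog q : K :=
  limn (series (fun k : nat => (-1) ^+ k * (q - 1) ^+ k.+1 / k.+1%:R : K)).

Definition pexp z : K := limn (series (fun k : nat => z ^+ k / k`!%:R : K)).

(* q^z, for |z| <= 1 *)
Definition qpow q z : K := pexp (z * plog q).

(* [z]_q *)
Definition qnum q z : K := (1 - qpow q z) / (1 - q).

(* [N]_{-q} *)
Definition qnumN q (N : nat) : K := (1 - (- q) ^+ N) / (1 + q).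

Definition fermionic_int q (f : padicZ K -> K) : K :=
  limn (fun N : nat =>
    (qnumN q (p ^ N))^-1 *
      \sum_(0 <= y < p ^ N) f (padicZ_nat K y) * (- q) ^+ y).

End PadicAnalysis.

Section QEuler.
Variables (p : nat) (R : realType) (K : padicFieldType p R).
Implicit Types (q z x lambda : K) (E : nat -> K).

(* Umbral evaluation: the linear map replacing 'X^k by E k. *)
Definition umbral E (P : {poly K}) : K := \sum_(k < size P) P`_k * E k.

Definition is_carlitz_euler q E : Prop :=
  E 0%N = 1 /\
  forall n, (0 < n)%N -> q * umbral E ((q *: 'X + 1) ^+ n) + E n = 0.

(* E_{n,q}; existence and uniqueness are [carlitz_eulerP] and
   [carlitz_euler_uniq]. *)
Definition carlitz_euler q : nat -> K :=
  xget (fun=> 0) [set E | is_carlitz_euler q E].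

(* E_{n,q}(x) *)
Definition q_euler_poly q (n : nat) x : K :=
  \sum_(l < n.+1)
    'C(n, l)%:R * qpow q (l%:R * x) * carlitz_euler q l * qnum q x ^+ (n - l).

(* Formal power series in t are represented by their coefficient sequences. *)

(* log(1 + lambda t) *)
Definition fps_log1p lambda (k : nat) : K :=
  if k is j.+1 then (-1) ^+ j * lambda ^+ k / k%:R else 0.

(* exp(g(t)) for a series g with g 0 = 0: truncating g beyond degree n and the
   exponential beyond its n-th term does not change the coefficient of t^n. *)
Definition fps_exp (g : nat -> K) (n : nat) : K :=
  \sum_(k < n.+1) ((\poly_(i < n.+1) g i) ^+ k)`_n / k`!%:R.

(* (1 + lambda t)^(z/lambda) *)
Definition fps_degen_pow lambda z : nat -> K :=
  fps_exp (fun k => z / lambda * fps_log1p lambda k).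

(* E_{n,q}(x|lambda): n! times the coefficient of t^n in the coefficientwise
   integral of (1 + lambda t)^([x+y]_q/lambda). *)
Definition degenerate_q_euler q (n : nat) x lambda : K :=
  n`!%:R *
    fermionic_int q (fun y : padicZ K => fps_degen_pow lambda (qnum q (x + val y)) n).

Lemma umbral_binomial E q n :
  umbral E ((q *: 'X + 1) ^+ n) = \sum_(k < n.+1) 'C(n, k)%:R * q ^+ k * E k.
Proof.
have cE k : ((q *: 'X + 1) ^+ n)`_k =
    if (k < n.+1)%N then 'C(n, k)%:R * q ^+ k else 0.
  rewrite addrC exprDn coef_sum.
  under eq_bigr => i _ do
    rewrite expr1n mul1r exprZn coefMn coefZ coefXn -mulrnAl -mulr_natl.
  case: ifP => kn.
    rewrite (bigD1 (Ordinal kn)) //= eqxx mulr1 big1 ?addr0 // => i ik.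
    by rewrite (_ : (k == i) = false) ?mulr0 //; apply: contraNF ik => /eqP ki;
      apply/eqP/val_inj.
  rewrite big1 // => i _; case: eqP => [ki|]; last by rewrite mulr0.
  by move: kn; rewrite ki ltn_ord.
have szP : (size (((q *: 'X + 1) : {poly K}) ^+ n) <= n.+1)%N.
  by apply/leq_sizeP => j nj; rewrite cE ltnNge nj.
rewrite /umbral (big_ord_widen _ (fun k => ((q *: 'X + 1) ^+ n)`_k * E k) szP).
rewrite big_mkcond; apply: eq_bigr => k _; rewrite cE ltn_ord.
case: ifPn => //; rewrite -leqNgt => sk.
by have := cE k; rewrite nth_default // ltn_ord => <-; rewrite mul0r.
Qed.

Lemma carlitz_eulerP q :
  (forall n, 1 + q ^+ n.+2 != 0) -> is_carlitz_euler q (carlitz_euler q).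
Proof.
move=> q1; apply: (xgetPex (fun=> 0)).
pose F := fix F n := if n is m.+1 then fun k : nat => if (k <= m)%N then F m k
  else - q * (\sum_(j < m.+1) 'C(m.+1, j)%:R * q ^+ j * F m j) / (1 + q ^+ m.+2)
  else fun _ : nat => 1 : K.
have FE m n : (m <= n)%N -> F n m = F m m.
  elim: n => [|n IH]; first by rewrite leqn0 => /eqP ->.
  by rewrite leq_eqVlt => /predU1P[-> //|mn] /=; rewrite -ltnS mn IH.
exists (fun n => F n n); split => // -[//|n] _.
rewrite umbral_binomial big_ord_recr /= binn mul1r ltnn.
under eq_bigr => k _ do rewrite -(FE k n) -1?ltnS //.
set S := \sum_(j < _) _; have := q1 n; rewrite (exprS q n.+1).
by move: (q ^+ n.+1) => r qr; field.
Qed.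

Lemma carlitz_euler_uniq q E E' : (forall n, 1 + q ^+ n.+2 != 0) ->
  is_carlitz_euler q E -> is_carlitz_euler q E' -> E =1 E'.
Proof.
move=> q1 [E0 ES] [E'0 E'S] n; elim/ltn_ind: n => -[_|n IH]; first by rewrite E0.
apply: (mulfI (q1 n)).
have := ES n.+1 isT; have := E'S n.+1 isT; rewrite !umbral_binomial.
rewrite big_ord_recr [in X in _ -> X -> _]big_ord_recr /= binn !mul1r.
rewrite [in X in _ -> X -> _](eq_bigr (fun k : 'I_n.+1 => 'C(n.+1, k)%:R * q ^+ k * E' k));
  last by move=> k _; rewrite IH.
set S := \sum_(_ < _) _; rewrite (exprS q n.+1).
move: (q ^+ n.+1) (E n.+1) (E' n.+1) => r e e' h' h; apply/eqP.
have eE : (1 + q * r) * e - (1 + q * r) * e' =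
    (q * (S + r * e) + e) - (q * (S + r * e') + e') by ring.
by rewrite -subr_eq0 eE h h' subrr.
Qed.

End QEuler.

(* The identity determines S n m for m <= n only; the other values are junk. *)
Definition is_stirling2 (S : nat -> nat -> nat) : Prop :=
  forall n, 'X^n = \sum_(m < n.+1)
    (S n m)%:R *: \prod_(i < m) ('X - i%:R%:P) :> {poly int}.

Lemma stirling2_exists : exists S, is_stirling2 S.
Proof.
pose S := fix S n m := match n, m with
  | 0, 0 => 1 | 0, _.+1 => 0 | _.+1, 0 => 0
  | k.+1, j.+1 => S k j + j.+1 * S k j.+1 end%N.
have S0 n m : (n < m)%N -> S n m = 0%N.
  elim: n m => [[]//|n IH] [//|m] nm /=.
  by rewrite !IH ?muln0 // ltnW.
pose f m : {poly int} := \prod_(i < m) ('X - i%:R%:P).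
have fX m : f m * 'X = f m.+1 + m%:R *: f m.
  by rewrite /f big_ord_recr /= -mul_polyC mulrBr [_%:P * _]mulrC subrK.
exists S => n; elim: n => [|n IH].
  by rewrite big_ord1 big_ord0 expr0 scale1r.
rewrite exprSr IH mulr_suml -/f [RHS]big_ord_recl /= scale0r add0r.
under [RHS]eq_bigr => i _ do rewrite /= natrD scalerDl.
under eq_bigr => i _ do rewrite -scalerAl -/(f i) fX scalerDr.
rewrite !big_split /=; congr (_ + _).
rewrite [LHS]big_ord_recl [RHS]big_ord_recr /= scale0r scaler0 add0r.
rewrite S0 // muln0 scale0r addr0.
by apply: eq_bigr => i _ /=; rewrite natrM scalerA mulrC.
Qed.

Definition stirling2 : nat -> nat -> nat := sval (cid stirling2_exists).

(* Main.v *)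
Require Import Defs.
From mathcomp Require Import all_boot all_order all_algebra.
From mathcomp Require Import all_classical all_reals all_analysis.
From mathcomp Require Import ring.

(* On natural numbers y, [x+y]_q = W(q^y) for the polynomial
   W(X) = (1 - q^x X)/(1 - q).  Since the fermionic integral of q^(l y) is
   (1 + q)/(1 + q^(l+1)), integration against mu_{-q} of P(q^y) is a linear
   functional I(P) of the polynomial P.  The recurrence of the Carlitz numbers
   gives E_n = I(((1 - X)/(1 - q))^n), whence E_n(x) = I(W^n), while
   m! [t^m] (1 + lambda t)^(z/lambda) is the product of the z - i lambda, i < m,
   so that E_m(x|lambda) is the value of I at the product of the W - i lambda.
   The claim is then I applied to the homogenized Stirling expansion of W^n.

   The laws exp(a + b) = exp(a) exp(b) and exp(log q) = q are obtained from
   truncated series: both sides are polynomials in one variable whose low-order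
   coefficients agree, and whose remaining coefficients are controlled by a
   Gauss norm at the radius of convergence p^(-1/(p-1)). *)

Set Implicit Arguments.
Unset Strict Implicit.
Unset Printing Implicit Defensive.

Import Order.TTheory GRing.Theory Num.Theory.

Local Open Scope ring_scope.

(** * Truncated exponentials of polynomials *)

Section TruncatedExponential.
Variable K : fieldType.
Hypothesis natK_neq0 : forall n, n.+1%:R != 0 :> K.
Implicit Types (G : {poly K}) (z lambda : K).

Lemma fact_neq0 n : n`!%:R != 0 :> K.
Proof. by rewrite -(prednK (fact_gt0 n)). Qed.

Definition exp_trunc n G : {poly K} := \sum_(k < n.+1) k`!%:R^-1 *: G ^+ k.

Lemma coef_expr_low G n j : G`_0 = 0 -> (j < n)%N -> (G ^+ n)`_j = 0.
Proof.
move=> G0 jn; have : root G 0 by rewrite rootE horner_coef0 G0.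
case/factor_theorem => H ->.
by rewrite subr0 exprMn coefMXn jn.
Qed.

(** Differentiation turns G^k/k! into G' G^(k-1)/(k-1)!, so the top term of the sum has no
    counterpart. When G(0) = 0 this defect has order at least n and is invisible below degree n. *)
Lemma deriv_exp_trunc n G :
  (exp_trunc n G)^`() = G^`() * (exp_trunc n G - n`!%:R^-1 *: G ^+ n).
Proof.
rewrite {2}/exp_trunc big_ord_recr /= addrK raddf_sum /= big_ord_recl /=.
rewrite expr0 derivZ derivC scaler0 add0r mulr_sumr; apply: eq_bigr => k _.
rewrite /= derivZ deriv_exp /= /bump /= add1n -scaler_nat scalerA -scalerAr.
congr (_ *: _); rewrite factS natrM invfM mulrAC mulVf ?mul1r //.
Qed.

(* F = exp G solves F' = G' F; the hypothesis on G says G' = z / (1 + lambda X). *)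
Lemma coef_exp_trunc n G z lambda :
  G`_0 = 0 ->
  (forall j, (j < n)%N -> ((1 + lambda *: 'X) * G^`())`_j = z *+ (j == 0)%N) ->
  forall j, (j <= n)%N ->
    j`!%:R * (exp_trunc n G)`_j = \prod_(i < j) (z - i%:R * lambda).
Proof.
move=> G0 dG; set F := exp_trunc n G.
(* The coefficient of X^j in (1 + lambda X) F' = z F is a one-step recurrence, whose solution is the
   product. *)
have step j : (j < n)%N -> j.+1%:R * F`_j.+1 = (z - j%:R * lambda) * F`_j.
  move=> jn.
  have -> : j.+1%:R * F`_j.+1 = F^`()`_j by rewrite coef_deriv mulr_natl.
  have : ((1 + lambda *: 'X) * F^`())`_j = z * F`_j.
    rewrite deriv_exp_trunc mulrA coefM (bigD1 ord0) //= subn0.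
    rewrite big1 ?addr0 => [|i i0]; last first.
      rewrite dG ?(leq_ltn_trans _ jn) -1?ltnS //.
      by rewrite (negPf (_ : (i : nat) != 0%N)) ?mul0r.
    rewrite dG ?(leq_ltn_trans _ jn) //= coefB coefZ coef_expr_low //.
    by rewrite mulr0 subr0.
  rewrite mulrDl mul1r -scalerAl coefD coefZ coefXM.
  move=> E; rewrite mulrBl -E.
  case: j {jn E} => [|j] /=; first by rewrite mulr0 !mul0r addr0 subr0.
  by rewrite !coef_deriv -[F`_j.+1 *+ _]mulr_natl; ring.
elim=> [|j IH] jn.
  rewrite big_ord0 mul1r /F /exp_trunc coef_sum big_ord_recl /= big1 => [|i _].
    by rewrite coefZ invr1 expr0 coef1 addr0 mul1r.
  by rewrite coefZ coef_expr_low ?mulr0.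
rewrite big_ord_recr /= -IH 1?ltnW // factS natrM.
by rewrite [_.+1%:R * _]mulrC -mulrA step // mulrA mulrAC.
Qed.

(** The second hypothesis gives the derivative of g the coefficients of the geometric series z / (1
    + lambda X); truncation beyond X^n leaves them intact below degree n. *)
Lemma coef_log_ode (g : nat -> K) n z lambda :
  g 0%N = 0 -> (forall j, j.+1%:R * g j.+1 = z * (- lambda) ^+ j) ->
  forall j, (j < n)%N ->
  ((1 + lambda *: 'X) * (\poly_(i < n.+1) g i)^`())`_j = z *+ (j == 0)%N.
Proof.
move=> g0 gS j jn.
rewrite mulrDl mul1r -scalerAl coefD coefZ coefXM !coef_deriv !coef_poly ltnS jn.
rewrite -[g _ *+ _]mulr_natl gS.
case: j jn => [|j] jn /=; first by rewrite mulr0 addr0 mulr1.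
by rewrite -ltnS in jn; rewrite (ltnW jn) -[g _ *+ _]mulr_natl gS exprS mulr0n; ring.
Qed.

End TruncatedExponential.

(** * Degenerate powers as products *)

Section Factorials.
Variables (p : nat) (R : realType) (K : padicFieldType p R).
Hypothesis natK_neq0 : forall n, n.+1%:R != 0 :> K.

Lemma fps_log1pS (lambda : K) j : j.+1%:R * fps_log1p lambda j.+1 = lambda * (- lambda) ^+ j.
Proof.
by rewrite /fps_log1p mulrC divfK // exprS mulrCA -exprMn mulN1r.
Qed.

Lemma fact_fps_degen_pow (lambda z : K) n : lambda != 0 ->
  n`!%:R * fps_degen_pow lambda z n = \prod_(i < n) (z - i%:R * lambda).
Proof.
move=> l0; rewrite /fps_degen_pow /fps_exp.
set g := fun k => _.
under eq_bigr => k _ do rewrite mulrC -coefZ.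
rewrite -coef_sum (@coef_exp_trunc K natK_neq0 n _ z lambda) //.
  by rewrite coef_poly /g /fps_log1p mulr0.
apply: coef_log_ode; first by rewrite /g /fps_log1p mulr0.
by move=> j; rewrite /g mulrCA fps_log1pS mulrA divfK.
Qed.

End Factorials.

(** * The functional given by the moments of the fermionic measure *)

Section Umbral.
Variables (p : nat) (R : realType) (K : padicFieldType p R).
Implicit Types (m : nat -> K) (P Q : {poly K}).

(** Any range covering the size may be used, so that polynomials of different sizes can be treated
    termwise. *)
Lemma umbralE m P n : (size P <= n)%N -> umbral m P = \sum_(k < n) P`_k * m k.
Proof.
move=> sPn; rewrite /umbral (big_ord_widen n (fun k => P`_k * m k)) //.
rewrite big_mkcond; apply: eq_bigr => k _; case: ifPn => //.
by rewrite -leqNgt => sk; rewrite nth_default ?mul0r.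
Qed.

Lemma umbralD m P Q : umbral m (P + Q) = umbral m P + umbral m Q.
Proof.
rewrite (umbralE m (size_polyD P Q)).
rewrite (umbralE m (leq_maxl (size P) (size Q))).
rewrite (umbralE m (leq_maxr (size P) (size Q))) -big_split.
by apply: eq_bigr => k _; rewrite coefD mulrDl.
Qed.

Lemma umbralZ m c P : umbral m (c *: P) = c * umbral m P.
Proof.
rewrite (umbralE m (size_scale_leq c P)) mulr_sumr.
by apply: eq_bigr => k _; rewrite coefZ mulrA.
Qed.

Lemma umbral0 m : umbral m 0 = 0.
Proof. by rewrite -(scale0r 0) umbralZ mul0r. Qed.

Lemma umbral_sum m I (s : seq I) (F : I -> {poly K}) :
  umbral m (\sum_(i <- s) F i) = \sum_(i <- s) umbral m (F i).
Proof.
by elim: s => [|i s IH]; rewrite ?big_nil ?umbral0 // !big_cons umbralD IH.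
Qed.

(* [moment q l] is the fermionic integral of q^(l y). *)
Definition moment (q : K) l : K := (1 + q) / (1 + q ^+ l.+1).

(* The fermionic invariance q I(f(y + 1)) + I(f) = (1 + q) f(0), for
   f(y) = P(q^y). *)
Lemma umbral_moment_shift q P : (forall l, 1 + q ^+ l.+1 != 0) ->
  q * umbral (moment q) (P \Po (q *: 'X)) + umbral (moment q) P
  = (1 + q) * P.[1].
Proof.
move=> q1; have sP : (size (P \Po (q *: 'X)) <= size P)%N.
  apply/leq_sizeP => j sj; rewrite comp_polyE coef_sum big1 // => i _.
  rewrite exprZn !coefZ coefXn (negPf (_ : j != i)) ?mulr0 //.
  by rewrite gtn_eqF // (leq_trans _ sj).
have cP k : (P \Po (q *: 'X))`_k = P`_k * q ^+ k.
  rewrite comp_polyE coef_sum; have [sk|sk] := ltnP k (size P).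
    rewrite (bigD1 (Ordinal sk)) //= exprZn !coefZ coefXn eqxx mulr1 big1 ?addr0 //.
    move=> i ik; rewrite exprZn !coefZ coefXn (negPf (_ : k != i)) ?mulr0 //.
    by apply: contra_neq ik => ki; apply/val_inj.
  rewrite (nth_default 0 sk) mul0r big1 // => i _.
  rewrite exprZn !coefZ coefXn (negPf (_ : k != i)) ?mulr0 //.
  by rewrite gtn_eqF // (leq_trans _ sk).
rewrite (umbralE _ sP) (umbralE _ (leqnn _)) mulr_sumr -big_split horner_coef.
rewrite mulr_sumr; apply: eq_bigr => k _ /=.
rewrite cP expr1n mulr1 /moment; have := q1 k; rewrite exprS.
by move: (q ^+ k) => r qr; field.
Qed.

(** For B = (1 - X)/(1 - q) one has [y]_q = B(q^y) and B(qX) = qB + 1. Hence the shift identity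
    applied to B^n is the Carlitz recurrence, and uniqueness identifies the two sequences. *)
Lemma carlitz_euler_moment q n : q != 1 -> (forall l, 1 + q ^+ l.+1 != 0) ->
  carlitz_euler q n = umbral (moment q) (((1 - q)^-1 *: (1 - 'X)) ^+ n).
Proof.
move=> q1 q1l; have qB : 1 - q != 0 by rewrite subr_eq0 eq_sym.
have q2 l : 1 + q ^+ l.+2 != 0 by [].
set B := (1 - q)^-1 *: (1 - 'X).
suff eB : is_carlitz_euler q (fun k => umbral (moment q) (B ^+ k)).
  exact: (carlitz_euler_uniq q2 (carlitz_eulerP q2) eB n).
split=> [|{}n n0].
  rewrite expr0 (umbralE _ (eq_leq (size_poly1 _))) big_ord1 coef1 mul1r.
  by rewrite /moment expr1 mulfV // -[q]expr1.
set m := moment q; pose E n := umbral m (B ^+ n).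
have comp k : B ^+ k \Po (q *: 'X) = (q *: B + 1) ^+ k.
  rewrite rmorphXn /=; congr (_ ^+ _).
  rewrite /B linearZ linearB /= comp_polyX comp_polyC.
  rewrite -!mul_polyC mulrDr mulr1.
  have c1 : ((1 - q)^-1)%:P * (1 - q%:P) = 1 :> {poly K}.
    by rewrite -polyCB -polyCM mulVf.
  by rewrite -[X in _ = _ + X]c1; ring.
have -> : umbral E ((q *: 'X + 1) ^+ n) = umbral m ((q *: B + 1) ^+ n).
  rewrite umbral_binomial [q *: B + 1]addrC exprDn umbral_sum.
  apply: eq_bigr => k _; rewrite expr1n mul1r exprZn -scaler_nat.
  by rewrite !umbralZ mulrA.
(* The right-hand side of the shift identity vanishes, since B(1) = 0 and n > 0. *)
rewrite -comp umbral_moment_shift // /B hornerE.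
by rewrite !hornerE subrr mulr0 expr0n eqn0Ngt n0 mulr0.
Qed.

End Umbral.

(** * The homogenized Stirling expansion *)

Section Stirling.
Variable K : fieldType.

Lemma stirling2_expand (W : {poly K}) (lambda : K) n : lambda != 0 ->
  W ^+ n = \sum_(m < n.+1) (lambda ^+ (n - m) * (stirling2 n m)%:R)
             *: \prod_(i < m) (W - (i%:R * lambda)%:P).
Proof.
move=> l0; have /(congr1 (map_poly (intr : int -> K))) := svalP (cid stirling2_exists) n.
rewrite -/stirling2 map_polyXn raddf_sum /= => /(congr1 (comp_poly (lambda^-1 *: W))).
rewrite rmorphXn /= comp_polyX exprZn => /(congr1 ( *:%R (lambda ^+ n))).
rewrite scalerA -exprMn mulfV // expr1n scale1r => ->.
rewrite raddf_sum scaler_sumr /=; apply: eq_bigr => -[m /= mn] _.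
rewrite map_polyZ linearZ /= rmorph_nat !rmorph_prod /= scalerA.
(* After the substitution X := W/lambda and multiplication by lambda^n, a factor lambda^m is split
   off and spread over the m linear factors. *)
rewrite -{1}(subnK (ltnSE mn)) exprD -mulrA [_ ^+ m * _]mulrC mulrA -scalerA.
congr (_ *: _); rewrite -mul_polyC rmorphXn /= -[X in _ ^+ X]card_ord -prodr_const.
rewrite -big_split; apply: eq_bigr => i _ /=.
rewrite rmorphB /= map_polyX map_polyC /= rmorphB /= comp_polyX comp_polyC.
rewrite mulrBr mul_polyC scalerA mulfV // scale1r rmorph_nat -polyCM.
by rewrite mulrC.
Qed.

End Stirling.

(** * Bounds on the valuations of k! and k + 1 *)

Section Legendre.
Variable p : nat.
Hypothesis hp : prime p.

Lemma logn_fact_le k : (p.-1 * logn p k`! <= k)%N.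
Proof.
rewrite logn_fact // -[k.+1 in X in (X <= _)%N]add1n.
(* The extra quotient makes Legendre's sum telescope: p times k %/ p^(m+1) is at most k %/ p^m. *)
suff H m : (p.-1 * (\sum_(1 <= i < m.+1) k %/ p ^ i) + k %/ p ^ m <= k)%N.
  exact: leq_trans (leq_addr _ _) (H k).
elim: m => [|m IH]; first by rewrite big_geq // muln0 expn0 divn1.
apply: leq_trans IH; rewrite big_nat_recr //= mulnDr -addnA leq_add2l.
rewrite -mulSnr (prednK (prime_gt0 hp)) expnSr divnMA mulnC.
exact: leq_trunc_div.
Qed.

(** With v the valuation, p^v divides k + 1, and (p - 1) v < p^v by induction on v. *)
Lemma logn_succ_le k : (p.-1 * logn p k.+1 <= k)%N.
Proof.
rewrite -ltnS; apply: leq_trans (dvdn_leq _ (pfactor_dvdnn p k.+1)) => //.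
elim: (logn p k.+1) => [|v IH]; first by rewrite muln0.
rewrite expnSr -{3}(prednK (prime_gt0 hp)) !mulnS addnC -addSn.
by rewrite leq_add // leq_pmull // expn_gt0 prime_gt0.
Qed.

End Legendre.

(** * Ultrametric estimates and the radius of convergence *)

Section Valuation.
Variables (p : nat) (R : realType) (K : padicFieldType p R).
Hypothesis hp : prime p.

Lemma pabs_sum I (s : seq I) (P : pred I) (F : I -> K) B : 0 <= B ->
  (forall i, P i -> pabs (F i) <= B) -> pabs (\sum_(i <- s | P i) F i) <= B.
Proof.
move=> B0 FB; elim/big_ind : _ => //; first by rewrite pabs0.
by move=> x y xB yB; rewrite (le_trans (pabs_ultra _ _)) // ge_max xB.
Qed.

Lemma pabsB_le (x y : K) B : pabs x <= B -> pabs y <= B -> pabs (x - y) <= B.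
Proof.
by move=> xB yB; rewrite (le_trans (pabs_ultra _ _)) // ge_max xB pabsN.
Qed.

Lemma pabsBC (x y : K) : pabs (x - y) = pabs (y - x).
Proof. by rewrite -pabsN opprB. Qed.

Lemma pabs_dist_le (y x z : K) B :
  pabs (x - y) <= B -> pabs (y - z) <= B -> pabs (x - z) <= B.
Proof.
move=> xy yz; rewrite -(subrKA y) (le_trans (pabs_ultra _ _)) //.
by rewrite ge_max xy.
Qed.

Lemma pabsX (x : K) n : pabs (x ^+ n) = pabs x ^+ n.
Proof. by elim: n => [|n IH]; rewrite ?expr0 ?pabs1 // !exprS pabsM IH. Qed.

Lemma pabsV (x : K) : pabs x^-1 = (pabs x)^-1.
Proof.
have [->|x0] := eqVneq x 0; first by rewrite invr0 pabs0 invr0.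
have n0 : pabs x != 0 by rewrite pabs_eq0.
by apply: (mulfI n0); rewrite -pabsM !mulfV // pabs1.
Qed.

Lemma pabs_nat_le1 n : pabs (n%:R : K) <= 1.
Proof.
elim: n => [|n IH]; first by rewrite pabs0 ler01.
by rewrite mulrS (le_trans (pabs_ultra _ _)) // ge_max pabs1 lexx.
Qed.

(** By Bezout 1 = a n - b p; if |n| < 1, both terms, hence 1 itself, would have absolute value below
    1. *)
Lemma pabs_coprime n : coprime p n -> pabs (n%:R : K) = 1.
Proof.
move=> pn; apply/eqP; rewrite eq_le pabs_nat_le1 /=.
have [a [b ab]] : exists a b, (a * n = b * p + 1)%N.
  have n0 : (0 < n)%N.
    by case: n pn => //; rewrite /coprime gcdn0 gtn_eqF ?prime_gt1.
  have [a b ab _] := egcdnP p n0.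
  by exists a, b; rewrite ab gcdnC (eqP pn).
rewrite leNgt; apply/negP => n1.
have : pabs (1 : K) < 1.
  have -> : (1 : K) = a%:R * n%:R - b%:R * p%:R.
    by rewrite -!natrM ab natrD addrAC subrr add0r.
  apply: le_lt_trans (pabs_ultra _ _) _; rewrite gt_max pabsN !pabsM.
  rewrite (le_lt_trans _ n1) ?ler_piMl ?pabs_ge0 ?pabs_nat_le1 //=.
  apply: (@le_lt_trans _ _ (pabs (p%:R : K))).
    by rewrite ler_piMl ?pabs_ge0 ?pabs_nat_le1.
  by rewrite pabs_p invf_lt1 ?ltr1n ?ltr0n ?prime_gt1 ?prime_gt0.
by rewrite pabs1 ltxx.
Qed.

Lemma pabs_natE n : (0 < n)%N -> pabs (n%:R : K) = p%:R^-1 ^+ logn p n.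
Proof.
move=> n0; have [m pm nE] := pfactor_coprime hp n0.
by rewrite {1}nE natrM natrX pabsM pabsX pabs_p pabs_coprime ?mul1r.
Qed.

Lemma natK_neq0 n : n.+1%:R != 0 :> K.
Proof.
by rewrite -pabs_eq0 pabs_natE // expf_neq0 // invr_neq0 // pnatr_eq0 -lt0n prime_gt0.
Qed.

Definition exp_radius : R := p%:R `^ (- (p.-1%:R)^-1).

Lemma exp_radius_gt0 : 0 < exp_radius.
Proof. by rewrite powR_gt0 // ltr0n prime_gt0. Qed.

Lemma exp_radiusX : exp_radius ^+ p.-1 = p%:R^-1.
Proof.
rewrite -powR_mulrn ?ltW ?exp_radius_gt0 // -powRrM mulNr mulVf ?powR_inv1 ?ler0n //.
by rewrite pnatr_eq0 -lt0n -subn1 subn_gt0 prime_gt1.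
Qed.

Lemma exp_radius_lt1 : exp_radius < 1.
Proof.
rewrite ltNge; apply/negP => /(exprn_ege1 p.-1); rewrite exp_radiusX leNgt.
by rewrite invf_lt1 ?ltr1n ?ltr0n ?prime_gt1 ?prime_gt0.
Qed.

(** With r the radius, r^(p-1) = 1/p, so |n| = r^((p-1) v) for v the valuation of n, and r < 1. *)
Lemma exp_radius_le_pabs k n : (0 < n)%N -> (p.-1 * logn p n <= k)%N ->
  exp_radius ^+ k <= pabs (n%:R : K).
Proof.
move=> n0 nk; rewrite pabs_natE // -exp_radiusX -exprM.
by apply: ler_wiXn2l => //; rewrite ltW ?exp_radius_gt0 ?exp_radius_lt1.
Qed.

Lemma exp_radius_fact k : exp_radius ^+ k <= pabs (k`!%:R : K).
Proof. by rewrite exp_radius_le_pabs ?fact_gt0 ?logn_fact_le. Qed.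

Lemma exp_radius_nat k : exp_radius ^+ k <= pabs (k.+1%:R : K).
Proof. by rewrite exp_radius_le_pabs ?logn_succ_le. Qed.

End Valuation.

(** * Limits at a geometric rate *)

Section GeometricLimits.
Variables (p : nat) (R : realType) (K : padicFieldType p R).
Implicit Types (C t : R).

Lemma geometric_lt C t e : 0 <= t < 1 -> 0 < e -> exists n, C * t ^+ n < e.
Proof.
move=> /andP[t0 t1] e0.
have nt : `|t| < 1 by rewrite ger0_norm.
have /cvgr_lt/(_ e e0) [N _ H] := cvg_geometric C nt.
by exists N; exact: H (leqnn N).
Qed.

Lemma eq_geometric (x y : K) C t : 0 <= t < 1 ->
  (forall n, pabs (x - y) <= C * t ^+ n) -> x = y.
Proof.
move=> t01 H; apply/eqP; rewrite -subr_eq0 -pabs_eq0 eq_le pabs_ge0 andbT.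
apply/ler_addgt0Pl => e e0; have [n Ce] := geometric_lt C t01 e0.
by rewrite addr0 (le_trans (H n)) // ltW.
Qed.

Lemma pabs_cvgP (u : nat -> K) (l : K) :
  (forall e, 0 < e -> exists N, forall n, (N <= n)%N -> pabs (l - u n) < e) <->
  (u @ \oo --> l)%classic.
Proof.
split=> [H|/cvg_ballP H e e0].
  by apply/cvg_ballP => e /H[N HN]; exists N => // n /=; exact: HN.
by have [N _ HN] := H e e0; exists N => n Nn; exact: HN Nn.
Qed.

Lemma limn_geometric (u : nat -> K) (l : K) C t : 0 <= t < 1 -> 0 <= C ->
  (forall n, pabs (l - u n) <= C * t ^+ n) -> limn u = l.
Proof.
move=> t01 C0 H; apply: cvg_lim; first exact: metric_hausdorff.
apply/pabs_cvgP => e e0; have [N CN] := geometric_lt C t01 e0.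
exists N => n Nn; apply: le_lt_trans (H n) _; apply: le_lt_trans CN.
have /andP[t0 /ltW t1] := t01.
by rewrite ler_wpM2l // ler_wiXn2l.
Qed.

Hypothesis hK : is_padic_complex K.

(** An ultrametric tail is bounded by its largest term, so the bound for the terms serves unchanged
    for the tails; completeness supplies the limit. *)
Lemma series_geometric (w : nat -> K) C t : 0 <= t < 1 -> 0 <= C ->
  (forall k, pabs (w k) <= C * t ^+ k) ->
  forall n, pabs (limn (series w) - series w n) <= C * t ^+ n.
Proof.
move=> t01 C0 wC; have /andP[t0 /ltW t1] := t01.
have tail n m : (n <= m)%N -> pabs (series w m - series w n) <= C * t ^+ n.
  move=> nm; rewrite sub_series_geq // big_nat_cond pabs_sum //.
    by rewrite mulr_ge0 ?exprn_ge0.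
  move=> k; rewrite andbT => /andP[nk _]; apply: le_trans (wC k) _.
  by rewrite ler_wpM2l // ler_wiXn2l.
have cvS : (cvg (series w @ \oo))%classic.
  apply: (padic_complete hK); apply: cauchy_exP => e e0.
  have [N CN] := geometric_lt C t01 e0.
  exists (series w N); exists N => // n /= Nn.
  by rewrite /ball /= /pdist pabsBC (le_lt_trans (tail _ _ Nn)).
move=> n; rewrite -[C * _](@max_l _ _ _ 0) ?mulr_ge0 ?exprn_ge0 //.
apply/ler_addgt0Pl => e e0.
have /pabs_cvgP/(_ e e0)[N HN] := cvS.
have Nl := leq_maxl N n; have nl := leq_maxr N n.
rewrite -(subrKA (series w (maxn N n))) (le_trans (pabs_ultra _ _)) //.
rewrite ge_max max_l ?mulr_ge0 ?exprn_ge0 //; apply/andP; split.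
  by rewrite (le_trans (ltW (HN _ Nl))) // lerDl mulr_ge0 ?exprn_ge0.
by rewrite (le_trans (tail _ _ nl)) // lerDr ltW.
Qed.

End GeometricLimits.

(** * Gauss norms of polynomials *)

Section GaussBound.
Variables (p : nat) (R : realType) (K : padicFieldType p R).
Implicit Types (C D s : R) (P Q : {poly K}).

(* The Gauss norm of P on the disc of radius 1/s is at most C. *)
Definition gauss_le C s P := forall j, pabs P`_j <= C * s ^+ j.

Lemma gauss_leM C D s P Q : 0 <= C -> 0 <= D -> 0 <= s ->
  gauss_le C s P -> gauss_le D s Q -> gauss_le (C * D) s (P * Q).
Proof.
move=> C0 D0 s0 PC QD j; rewrite coefM pabs_sum ?mulr_ge0 ?exprn_ge0 // => i _.
have -> : C * D * s ^+ j = C * s ^+ i * (D * s ^+ (j - i)).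
  by rewrite mulrACA -exprD subnKC // -ltnS.
by rewrite pabsM ler_pM ?pabs_ge0.
Qed.

Lemma gauss_leX C s P n : 0 <= C -> 0 <= s ->
  gauss_le C s P -> gauss_le (C ^+ n) s (P ^+ n).
Proof.
move=> C0 s0 PC; elim: n => [|n IH].
  move=> j; rewrite !expr0 mul1r coef1; case: j => [|j]; rewrite /= ?pabs1 //.
  by rewrite pabs0 exprn_ge0.
by rewrite !exprS; apply: gauss_leM => //; rewrite exprn_ge0.
Qed.

Lemma pabs_horner_le C s P u n : 0 <= C -> 0 <= s -> s * pabs u <= 1 ->
  gauss_le C s P -> (forall j, (j < n)%N -> P`_j = 0) ->
  pabs P.[u] <= C * (s * pabs u) ^+ n.
Proof.
move=> C0 s0 su PC P0; have su0 : 0 <= s * pabs u by rewrite mulr_ge0 ?pabs_ge0.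
rewrite horner_coef pabs_sum ?mulr_ge0 ?exprn_ge0 // => j _.
have [jn|nj] := ltnP j n.
  by rewrite P0 // mul0r pabs0 mulr_ge0 ?exprn_ge0.
apply: (@le_trans _ _ (C * (s * pabs u) ^+ j)).
  by rewrite pabsM pabsX exprMn mulrA ler_wpM2r // exprn_ge0 ?pabs_ge0.
by rewrite ler_wpM2l // ler_wiXn2l.
Qed.

End GaussBound.

(** * The p-adic exponential and logarithm *)

Section PadicExp.
Variables (p : nat) (R : realType) (K : padicFieldType p R).
Hypothesis hp : prime p.
Hypothesis hK : is_padic_complex K.
Implicit Types (a b q u : K).
Local Notation r := (exp_radius p R).
Let r_gt0 : 0 < r := exp_radius_gt0 R hp.
Let r_ge0 : 0 <= r := ltW r_gt0.
Let natK0 := natK_neq0 K hp.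

Definition exp_term a k : K := a ^+ k / k`!%:R.

Lemma pabs_exp_term a k : pabs (exp_term a k) <= (pabs a / r) ^+ k.
Proof.
rewrite pabsM pabsV pabsX expr_div_n ler_wpM2l ?exprn_ge0 ?pabs_ge0 //.
rewrite lef_pV2 ?exp_radius_fact // posrE ?exprn_gt0 //.
by rewrite lt_neqAle pabs_ge0 eq_sym pabs_eq0 fact_neq0.
Qed.

Lemma ratio_lt1 a : pabs a < r -> 0 <= pabs a / r < 1.
Proof. by move=> ar; rewrite divr_ge0 ?pabs_ge0 //= ltr_pdivrMr // mul1r. Qed.

Lemma pexp_approx a n : pabs a < r ->
  pabs (pexp a - series (exp_term a) n) <= (pabs a / r) ^+ n.
Proof.
move=> ar; rewrite -[X in _ <= X]mul1r.
apply: (series_geometric hK (ratio_lt1 ar)) => // k.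
by rewrite mul1r pabs_exp_term.
Qed.

Lemma pexp_sub1 a : pabs a < r -> pabs (pexp a - 1) <= pabs a / r.
Proof.
move=> ar; have := pexp_approx 1 ar; rewrite expr1 /series /= big_nat1.
by rewrite /exp_term expr0 fact0 divr1.
Qed.

Lemma pexp0 : pexp (0 : K) = 1.
Proof.
apply/eqP; rewrite -subr_eq0 -pabs_eq0 eq_le pabs_ge0 andbT.
by have := @pexp_sub1 0; rewrite pabs0 mul0r; apply.
Qed.

Lemma pabs_pexp_le1 a : pabs a < r -> pabs (pexp a) <= 1.
Proof.
move=> ar; rewrite -[pexp a](subrK 1) (le_trans (pabs_ultra _ _)) //.
rewrite ge_max pabs1 lexx andbT (le_trans (pexp_sub1 ar)) //.
by have /andP[_ /ltW] := ratio_lt1 ar.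
Qed.

Lemma pabs_exp_series_le1 a n : pabs a <= r -> pabs (series (exp_term a) n) <= 1.
Proof.
move=> ar; rewrite pabs_sum // => k _; apply: le_trans (pabs_exp_term a k) _.
by rewrite exprn_ile1 ?divr_ge0 ?pabs_ge0 // ler_pdivrMr ?mul1r.
Qed.

(** In a^k - b^k the cofactor of a - b is at most r^(k-1), and |k!| >= r^k leaves the constant
    1/r. *)
Lemma exp_series_lipschitz a b n : pabs a <= r -> pabs b <= r ->
  pabs (series (exp_term a) n - series (exp_term b) n) <= pabs (a - b) / r.
Proof.
move=> ar br; rewrite /series /= -sumrB pabs_sum ?divr_ge0 ?pabs_ge0 // => -[|k] _.
  by rewrite /exp_term subrr pabs0 divr_ge0 ?pabs_ge0.
rewrite /exp_term -mulrBl subrXX !pabsM pabsV -mulrA ler_wpM2l ?pabs_ge0 //.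
have f0 : 0 < pabs (k.+1`!%:R : K).
  by rewrite lt_neqAle pabs_ge0 eq_sym pabs_eq0 fact_neq0.
rewrite ler_pdivrMr // ler_pdivlMl // (le_trans _ (exp_radius_fact K hp k.+1)) //.
rewrite exprS ler_wpM2l // pabs_sum ?exprn_ge0 // => i _.
have -> : r ^+ k = r ^+ (k.+1.-1 - i) * r ^+ i by rewrite -exprD subnK // -ltnS.
by rewrite pabsM !pabsX ler_pM ?exprn_ge0 ?pabs_ge0 // lerXn2r ?nnegrE ?pabs_ge0.
Qed.

(** The partial sums are values at X = 1 of truncations [P c] of exp(c X). The polynomial P(a + b) -
    P(a) P(b) vanishes below degree n by the binomial theorem, and its coefficient at X^j is at most
    t^j. *)
Lemma exp_seriesD a b t n :
  pabs a / r <= t -> pabs b / r <= t -> t <= 1 ->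
  pabs (series (exp_term (a + b)) n
        - series (exp_term a) n * series (exp_term b) n) <= t ^+ n.
Proof.
move=> at_ bt t1.
have t0 : 0 <= t by rewrite (le_trans _ at_) // divr_ge0 ?pabs_ge0.
pose P c : {poly K} := \poly_(k < n) exp_term c k.
have PE c : (P c).[1] = series (exp_term c) n.
  rewrite /series /= big_mkord horner_poly.
  by apply: eq_bigr => k _; rewrite expr1n mulr1.
have Pt c : pabs c / r <= t -> gauss_le 1 t (P c).
  move=> ct j; rewrite coef_poly mul1r; case: ifP => _; last first.
    by rewrite pabs0 exprn_ge0.
  rewrite (le_trans (pabs_exp_term _ _)) // lerXn2r ?nnegrE //.
  by rewrite divr_ge0 ?pabs_ge0.
have abt : pabs (a + b) / r <= t.
  rewrite ler_pdivrMr // (le_trans (pabs_ultra _ _)) // ge_max.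
  by rewrite -!ler_pdivrMr // at_.
rewrite -!PE -hornerM -hornerN -hornerD.
have -> : t ^+ n = 1 * (t * pabs (1 : K)) ^+ n by rewrite pabs1 mulr1 mul1r.
apply: pabs_horner_le => //; first by rewrite pabs1 mulr1.
  move=> j; rewrite coefB pabsB_le //; first exact: Pt.
  by rewrite -[X in X * _ ^+ _]mulr1; apply: gauss_leM; rewrite ?ler01 //; exact: Pt.
move=> j jn; rewrite coefB coefMr coef_poly jn; apply/eqP; rewrite subr_eq0; apply/eqP.
rewrite /exp_term exprDn mulr_suml; apply: eq_bigr => i _.
have ij : (i <= j)%N by rewrite -ltnS.
rewrite !coef_poly (leq_ltn_trans ij jn) (leq_ltn_trans (leq_subr _ _) jn).
have /(congr1 (fun m : nat => m%:R : K)) := bin_fact ij; rewrite !natrM => <-.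
have bn : 'C(j, i)%:R != 0 :> K by rewrite -(prednK (_ : 0 < 'C(j, i))%N) ?bin_gt0.
have := fact_neq0 natK0 i; have := fact_neq0 natK0 (j - i).
rewrite -[_ *+ 'C(j, i)]mulr_natr /exp_term; move: (_`!%:R) (_`!%:R) ('C(_, _)%:R : K) bn => F G B B0 G0 F0.
by field; rewrite F0 G0 B0.
Qed.

Lemma pexpD a b : pabs a < r -> pabs b < r -> pexp (a + b) = pexp a * pexp b.
Proof.
move=> ar br.
(* By symmetry the single ratio t = |b|/r controls a, b and a + b; each replacement of a series by
   its n-th partial sum then costs at most t^n. *)
wlog ab : a b ar br / pabs a <= pabs b.
  by move=> H; have [|/ltW] := leP (pabs a) (pabs b);
    [exact: H | rewrite addrC mulrC; exact: H].
have t01 := ratio_lt1 br; have /andP[t0 /ltW t1] := t01.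
have abt : pabs a / r <= pabs b / r by rewrite ler_wpM2r // invr_ge0.
have abr : pabs (a + b) <= pabs b.
  by rewrite (le_trans (pabs_ultra _ _)) // ge_max ab lexx.
apply: (eq_geometric (C := 1) t01) => n; rewrite mul1r.
apply: (@pabs_dist_le _ _ _ (series (exp_term (a + b)) n)).
  apply: le_trans (pexp_approx n (le_lt_trans abr br)) _.
  by rewrite lerXn2r ?nnegrE ?divr_ge0 ?pabs_ge0 // ler_wpM2r // invr_ge0.
apply: (@pabs_dist_le _ _ _ (series (exp_term a) n * series (exp_term b) n)).
  exact: exp_seriesD.
apply: (@pabs_dist_le _ _ _ (pexp a * series (exp_term b) n)).
  rewrite -mulrBl pabsM -[X in _ <= X]mulr1 ler_pM ?pabs_ge0 //.
    rewrite pabsBC (le_trans (pexp_approx n ar)) //.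
    by rewrite lerXn2r ?nnegrE ?divr_ge0 ?pabs_ge0.
  by rewrite pabs_exp_series_le1 // ltW.
rewrite -mulrBr pabsM -[X in _ <= X]mul1r ler_pM ?pabs_ge0 //.
  exact: pabs_pexp_le1.
by rewrite pabsBC pexp_approx.
Qed.

Definition log_term u k : K := (-1) ^+ k * u ^+ k.+1 / k.+1%:R.

Lemma plog_approx q n : pabs (q - 1) < r ->
  pabs (plog q - series (log_term (q - 1)) n)
    <= pabs (q - 1) * (pabs (q - 1) / r) ^+ n.
Proof.
move=> qr; apply: (series_geometric hK (ratio_lt1 qr)); first exact: pabs_ge0.
move=> k; rewrite /log_term !pabsM pabsV !pabsX pabsN pabs1 expr1n mul1r.
rewrite exprS -mulrA ler_wpM2l ?pabs_ge0 // expr_div_n.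
rewrite ler_wpM2l ?exprn_ge0 ?pabs_ge0 // lef_pV2 ?exp_radius_nat //.
  by rewrite posrE lt_neqAle pabs_ge0 eq_sym pabs_eq0 natK0.
by rewrite posrE exprn_gt0.
Qed.

Lemma pabs_plog q : pabs (q - 1) < r -> pabs (plog q) <= pabs (q - 1).
Proof.
move=> qr; have := plog_approx 0 qr.
by rewrite /series /= big_nil subr0 expr0 mulr1.
Qed.

(** Let [G] be log(1 + X) truncated at degree n. Its truncated exponential agrees with 1 + X through
    degree n, and the difference, of Gauss norm at most 1 at radius r, is small at X = q - 1. *)
Lemma pexp_plog q : pabs (q - 1) < r -> pexp (plog q) = q.
Proof.
move=> qr; set u := q - 1; have t01 := ratio_lt1 qr; have /andP[t0 /ltW t1] := t01.
rewrite -/u in t01 t0 t1.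
have Lr : pabs (plog q) < r := le_lt_trans (pabs_plog qr) qr.
apply: (eq_geometric (C := 1) t01) => n; rewrite mul1r.
pose G : {poly K} := \poly_(i < n.+1) fps_log1p 1 i.
pose l := G.[u].
have lE : l = series (log_term u) n.
  rewrite /l /G horner_poly big_ord_recl /= mul0r add0r /series /= big_mkord.
  by apply: eq_bigr => k _; rewrite /log_term /bump /= add1n expr1n mulr1 mulrAC.
have Ll : pabs (plog q - l) <= pabs u * (pabs u / r) ^+ n.
  by rewrite lE plog_approx.
have lr : pabs l <= r.
  rewrite -[l](subrK (plog q)) (le_trans (pabs_ultra _ _)) // ge_max (ltW Lr) andbT.
  rewrite pabsBC (le_trans Ll) // (le_trans _ (ltW qr)) // ler_piMr ?pabs_ge0 //.
  by rewrite exprn_ile1.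
have le_n : (pabs u / r) ^+ n.+1 <= (pabs u / r) ^+ n by rewrite ler_wiXn2l.
apply: (@pabs_dist_le _ _ _ (series (exp_term (plog q)) n.+1)).
  apply: le_trans (pexp_approx _ Lr) _; apply: le_trans le_n.
  rewrite lerXn2r ?nnegrE ?divr_ge0 ?pabs_ge0 //.
  by rewrite ler_wpM2r ?invr_ge0 // pabs_plog.
(* The Lipschitz bound replaces the logarithm by its truncation inside the exponential sum. *)
apply: (@pabs_dist_le _ _ _ (series (exp_term l) n.+1)).
  apply: le_trans (exp_series_lipschitz _ (ltW Lr) lr) _.
  rewrite (le_trans _ le_n) // exprS ler_pdivrMr // mulrAC divfK ?gt_eqF //.
have -> : series (exp_term l) n.+1 = (exp_trunc n G).[u].
  rewrite /series /= big_mkord /exp_trunc horner_sum; apply: eq_bigr => k _.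
  by rewrite hornerZ horner_exp mulrC.
have -> : q = ('X + 1).[u] by rewrite !hornerE subrK.
rewrite -hornerN -hornerD; apply: le_trans le_n.
have rV0 : 0 <= r^-1 by rewrite invr_ge0.
rewrite -[X in _ <= X]mul1r [pabs u / r]mulrC; apply: pabs_horner_le => //.
- by rewrite mulrC.
(* [G] has Gauss norm at most r, so |k!| >= r^k bounds that of G^k/k! by 1. *)
- have Gr : gauss_le r r^-1 G.
    move=> j; rewrite coef_poly; case: ifP => _; last first.
      by rewrite pabs0 mulr_ge0 ?exprn_ge0.
    case: j => [|j]; first by rewrite /= pabs0 mulr_ge0 ?exprn_ge0.
    rewrite /= expr1n mulr1 pabsM pabsX pabsN pabs1 expr1n mul1r pabsV.
    rewrite exprS mulrA mulfV ?gt_eqF // mul1r exprVn lef_pV2 ?exp_radius_nat //.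
      by rewrite posrE lt_neqAle pabs_ge0 eq_sym pabs_eq0 natK0.
    by rewrite posrE exprn_gt0.
  move=> j; rewrite coefB pabsB_le //.
    rewrite coef_sum pabs_sum ?mul1r ?exprn_ge0 // => k _.
    rewrite coefZ pabsM pabsV.
    have f0 : 0 < pabs (k`!%:R : K).
      by rewrite lt_neqAle pabs_ge0 eq_sym pabs_eq0 fact_neq0.
    rewrite ler_pdivrMl // (le_trans (gauss_leX k r_ge0 rV0 Gr j)) //.
    by rewrite ler_wpM2r ?exprn_ge0 // exp_radius_fact.
  rewrite coefD coefX coef1 mul1r (@le_trans _ _ 1) //.
    by case: j => [|[|j]]; rewrite /= ?add0r ?addr0 ?pabs0 ?pabs1.
  by rewrite exprn_ege1 // invf_ge1 // ltW // exp_radius_lt1.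
(* Here j! times the coefficient is the product of the 1 - i, i < j, which the factor i = 1 kills
   for j >= 2. *)
move=> j jn; have := coef_exp_trunc (z := 1) (lambda := 1) natK0 _ _ (jn : (j <= n)%N).
have f0 := fact_neq0 natK0 j.
move=> /(_ G) cG; apply/eqP; rewrite coefB subr_eq0; apply/eqP.
apply: (mulfI f0); rewrite cG.
- rewrite coefD coefX coef1; case: j {jn f0 cG} => [|[|j]].
  + by rewrite big_ord0 add0r mulr1.
  + by rewrite big_ord_recl big_ord0 /= mul0r subr0 addr0 !mulr1.
  + rewrite (bigD1 (Ordinal (isT : 1 < j.+2)%N)) //= mul1r subrr mul0r addr0.
    by rewrite mulr0.
- by rewrite coef_poly.
by apply: coef_log_ode => // i; exact: fps_log1pS.
Qed.

End PadicExp.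

(** * Powers of q and fermionic integrals of polynomials in q^y *)

Section QPower.
Variables (p : nat) (R : realType) (K : padicFieldType p R).
Hypothesis hp : prime p.
Hypothesis hK : is_padic_complex K.
Variable q : K.
Hypothesis hq : pabs (q - 1) < exp_radius p R.

Lemma pabs_mul_plog (z : K) : pabs z <= 1 ->
  pabs (z * plog q) < exp_radius p R.
Proof.
move=> z1; apply: le_lt_trans hq; apply: le_trans (pabs_plog hp hK hq).
by rewrite pabsM ler_piMl ?pabs_ge0.
Qed.

Lemma qpowD (z w : K) : pabs z <= 1 -> pabs w <= 1 ->
  qpow q (z + w) = qpow q z * qpow q w.
Proof. by move=> z1 w1; rewrite /qpow mulrDl pexpD ?pabs_mul_plog. Qed.

Lemma qpow_mulrn n (z : K) : pabs z <= 1 -> qpow q (n%:R * z) = qpow q z ^+ n.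
Proof.
move=> z1; elim: n => [|n IH]; first by rewrite mul0r /qpow mul0r pexp0.
rewrite mulrSr mulrDl mul1r qpowD // ?IH ?exprSr //.
by rewrite pabsM mulr_ile1 ?pabs_ge0 ?pabs_nat_le1.
Qed.

Lemma qpow_nat n : qpow q n%:R = q ^+ n.
Proof. by rewrite -[n%:R]mulr1 qpow_mulrn ?pabs1 // /qpow mul1r pexp_plog. Qed.

(** From q^n = exp(n log q), |exp a - 1| <= |a|/r and |log q| < r. For n = p^N this gives the rate
    of convergence of the integral. *)
Lemma pabs_exp_sub1 n : pabs (q ^+ n - 1) <= pabs (n%:R : K).
Proof.
rewrite -qpow_nat; have n1 := pabs_nat_le1 K n.
apply: le_trans (pexp_sub1 hp hK (pabs_mul_plog n1)) _.
rewrite ler_pdivrMr ?exp_radius_gt0 // pabsM ler_wpM2l ?pabs_ge0 //.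
by rewrite (le_trans (pabs_plog hp hK hq)) // ltW.
Qed.

Hypothesis hodd : odd p.

(** In 1 + q^n = 2 + (q^n - 1) the first term is a unit because p is odd, and the second is smaller
    than 1. *)
Lemma pabs_1DqX n : pabs (1 + q ^+ n) = 1.
Proof.
have q1 : pabs (q ^+ n - 1) < 1.
  rewrite subrX1 pabsM; apply: le_lt_trans (lt_trans hq (exp_radius_lt1 R hp)).
  rewrite ler_piMr ?pabs_ge0 // pabs_sum // => i _.
  rewrite pabsX exprn_ile1 ?pabs_ge0 // -[q](subrK 1).
  rewrite (le_trans (pabs_ultra _ _)) // ge_max pabs1 lexx andbT.
  by rewrite ltW // (lt_trans hq) // exp_radius_lt1.
have two : pabs (2%:R : K) = 1.
  by apply: pabs_coprime => //; rewrite coprime_sym prime_coprime // dvdn2 negbK.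
apply/eqP; rewrite eq_le; apply/andP; split.
  have -> : 1 + q ^+ n = 2%:R + (q ^+ n - 1) by ring.
  by rewrite (le_trans (pabs_ultra _ _)) // ge_max two lexx ltW.
have := pabs_ultra (1 + q ^+ n) (1 - q ^+ n).
have -> : 1 + q ^+ n + (1 - q ^+ n) = 2%:R by ring.
by rewrite two le_max [pabs (1 - _)]pabsBC [X in _ || X]leNgt q1 orbF.
Qed.

Lemma onepq_neq0 n : 1 + q ^+ n != 0.
Proof. by rewrite -pabs_eq0 pabs_1DqX oner_eq0. Qed.

(** The approximating sums sample [f] only at natural numbers, and there they split into one
    geometric sum for each monomial of [P]. *)
Lemma fermionic_int_poly (P : {poly K}) (f : padicZ K -> K) :
  (forall y : nat, f (padicZ_nat K y) = P.[q ^+ y]) ->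
  fermionic_int q f = umbral (moment q) P.
Proof.
move=> fP; pose C := \sum_(l < size P) pabs (P`_l * moment q l).
have C0 : 0 <= C by apply: sumr_ge0 => l _; exact: pabs_ge0.
have p01 : 0 <= (p%:R^-1 : R) < 1.
  by rewrite invr_ge0 ler0n invf_lt1 ?ltr1n ?ltr0n ?prime_gt1 ?prime_gt0.
apply: (limn_geometric p01 C0) => N.
set M := (p ^ N)%N; have Modd : odd M by rewrite oddX hodd orbT.
(* The ratio is -q^(l+1), and the sign of its M-th power is fixed by M being odd. *)
have gsum l : \sum_(0 <= y < M) (q ^+ y) ^+ l * (- q) ^+ y
    = (1 + (q ^+ M) ^+ l.+1) / (1 + q ^+ l.+1).
  have q0 := onepq_neq0 l.+1.
  apply: (mulIf q0); rewrite divfK // mulrC big_mkord.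
  have -> : 1 + q ^+ l.+1 = - (- q ^+ l.+1 - 1) by ring.
  have -> : \sum_(y < M) (q ^+ y) ^+ l * (- q) ^+ y
      = \sum_(y < M) (- q ^+ l.+1) ^+ y.
    by apply: eq_bigr => y _; rewrite exprAC -exprMn mulrN -exprSr.
  rewrite mulNr -subrX1 exprNn -signr_odd Modd expr1 mulN1r -!exprM mulnC.
  by ring.
have -> : \sum_(0 <= y < M) f (padicZ_nat K y) * (- q) ^+ y
    = \sum_(l < size P) P`_l * ((1 + (q ^+ M) ^+ l.+1) / (1 + q ^+ l.+1)).
  under eq_bigr => y _ do rewrite fP horner_coef mulr_suml.
  rewrite exchange_big; apply: eq_bigr => l _ /=.
  by rewrite -gsum mulr_sumr; apply: eq_bigr => y _; rewrite mulrA.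
rewrite mulr_sumr /umbral -sumrB.
have /andP[p0 /ltW p1] := p01.
rewrite pabs_sum ?mulr_ge0 ?exprn_ge0 // => l _.
(* The error in each term is the limit times a factor containing 1 - q^(M l), of size at most |M| =
   p^(-N). *)
have -> : P`_l * moment q l - (qnumN q M)^-1 *
    (P`_l * ((1 + (q ^+ M) ^+ l.+1) / (1 + q ^+ l.+1))) =
    P`_l * moment q l * ((1 - q ^+ M ^+ l) * q ^+ M / (1 + q ^+ M)).
  have := onepq_neq0 l.+1; have := onepq_neq0 M; have := onepq_neq0 1.
  rewrite expr1 /moment /qnumN exprNn -signr_odd Modd expr1 mulN1r opprK.
  rewrite [(q ^+ M) ^+ l.+1]exprS.
  move: (P`_l) (q ^+ M) (q ^+ l.+1) => c u v h1 h2 h3.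
  by move: (u ^+ l) => w; field; rewrite h1 h2 h3.
rewrite pabsM ler_pM ?pabs_ge0 //.
  by rewrite /C (bigD1 l) //= lerDl sumr_ge0 // => i _; exact: pabs_ge0.
rewrite !pabsM pabsV pabs_1DqX invr1 mulr1.
have qM1 : pabs (q ^+ M) <= 1.
  rewrite -[q ^+ M](subrK 1) (le_trans (pabs_ultra _ _)) // ge_max pabs1 lexx andbT.
  by rewrite (le_trans (pabs_exp_sub1 _)) // pabs_nat_le1.
apply: (@le_trans _ _ (pabs (1 - q ^+ M ^+ l))).
  by rewrite ler_piMr ?pabs_ge0.
rewrite pabsBC -exprM (le_trans (pabs_exp_sub1 _)) // natrM pabsM.
rewrite /M natrX pabsX pabs_p.
by rewrite ler_piMr ?pabs_nat_le1 // exprn_ge0.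
Qed.

End QPower.

(** * Assembly of the identity *)

Theorem theorem2p2 (p : nat) (hp : prime p) (hodd : odd p)
  (R : realType) (K : padicFieldType p R) (hK : is_padic_complex K) (q lambda x : K)
  (hq1 : q != 1) (hq : pabs (q - 1) < (p%:R : R) `^ (- (p.-1%:R)^-1))
  (hlambda : lambda != 0) (hx : pabs x <= 1) (n : nat) :
  q_euler_poly q n x =
    \sum_(m < n.+1) degenerate_q_euler q m x lambda * lambda ^+ (n - m)
                    * (stirling2 n m)%:R.
Proof.
have q1 l : 1 + q ^+ l.+1 != 0 by exact: onepq_neq0.
have qB : 1 - q != 0 by rewrite subr_eq0 eq_sym.
set B : {poly K} := (1 - q)^-1 *: (1 - 'X).
set X0 := qpow q x.
(* This form encodes [x+y]_q = [x]_q + q^x [y]_q, so the binomial expansion of W^n matches the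
   definition of [q_euler_poly]. *)
pose W := (qnum q x)%:P + X0 *: B.
have WE y : qnum q (x + y%:R) = W.[q ^+ y].
  rewrite /qnum (qpowD hp hK hq) ?pabs_nat_le1 // (qpow_nat hp hK hq) -/X0.
  by rewrite /W /B !hornerE /qnum -/X0 /=; field.
transitivity (umbral (moment q) (W ^+ n)).
  rewrite /W exprDn umbral_sum; apply: eq_bigr => l _.
  rewrite -scaler_nat -rmorphXn /= mul_polyC exprZn !umbralZ.
  rewrite -carlitz_euler_moment // (qpow_mulrn hp hK hq) // -/X0.
  by ring.
rewrite (stirling2_expand W n hlambda) umbral_sum; apply: eq_bigr => m _.
rewrite umbralZ -mulrA mulrC; congr (_ * _).
have m0 := fact_neq0 (natK_neq0 K hp) m.
rewrite /degenerate_q_euler.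
(* At natural y the coefficient of t^m is this polynomial evaluated at q^y; the factor m! in
   [degenerate_q_euler] cancels its denominator. *)
rewrite (@fermionic_int_poly _ _ _ hp hK q hq hodd
  (m`!%:R^-1 *: \prod_(i < m) (W - (i%:R * lambda)%:P))).
  by rewrite umbralZ mulrA mulfV // mul1r.
move=> y; apply: (mulfI m0).
rewrite fact_fps_degen_pow //; last exact: natK_neq0.
rewrite hornerZ mulrA mulfV // mul1r horner_prod; apply: eq_bigr => i _.
by rewrite /= WE !hornerE.
Qed.
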